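(* The scheduler $\mathsf{ins}$ is a $2$-competitive instantly-committing scheduler for the One-Fast-Many-Slow Decision Problem; that is, on every task arrival process its completion time is at most twice the optimal offline completion time.
   Context: One-Fast-Many-Slow Decision Problem: there is a single fast machine and an unlimited number of slow machines. An instance is a task arrival process (TAP) $\mathcal{T}=(\tau_1,\dots,\tau_n)$, where $\tau_i=(\sigma_i,\pi_i,t_i)$ gives the task's runtime $\sigma_i$ on a slow machine, its runtime $\pi_i$ on the fast machine, and its arrival time $t_i$, with $t_1\le\dots\le t_n$. A valid schedule assigns at most one task to each machine at each time, does no work on a task before its arrival time, runs each task on at most one machine, and runs each task $\tau_i$ either for a total of $\sigma_i$ time on some slow machine or for a total of $\pi_i$ time on the fast machine. The completion time is the time when the last task finishes. An online scheduler learns each task only at its arrival time; an instantly-committing scheduler must fix, at each task's arrival time, which machine that task will run on. A scheduler is $c$-competitive if on every TAP its completion time is at most $c$ times the minimum completion time of an offline valid schedule for that TAP. For $t\ge0$, $\mathcal{T}^t$ is the truncation of $\mathcal{T}$ to tasks with $t_i\le t$, and $C^t$ is the minimum completion time of any valid offline schedule for $\mathcal{T}^t$. The scheduler $\mathsf{ins}$: when task $\tau_i$ arrives, if $\sigma_i+t_i>2C^{t_i}$ run $\tau_i$ on the fast machine (the fast machine processing its tasks in order of arrival); otherwise run $\tau_i$ on a slow machine. *)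

(* Defs.v *)
From HB Require Import structures.
From mathcomp Require Import all_boot all_order all_algebra.
From mathcomp Require Import all_classical all_reals all_analysis.

Set Implicit Arguments.
Unset Strict Implicit.
Unset Printing Implicit Defensive.

Import Order.TTheory GRing.Theory Num.Theory.

Local Open Scope classical_set_scope.
Local Open Scope ring_scope.

Record task (R : realType) := Task {
  slow_time : R;
  fast_time : R;
  arrival : R }.

(* Tasks are referred to by their 0-based index in a sequence; [task0] is only
   the default value of [nth]. *)
Definition task0 (R : realType) : task R := Task 0 0 0.

Definition tsk (R : realType) (T : seq (task R)) (i : nat) : task R :=
  nth (task0 R) T i.

Definition is_tap (R : realType) (T : seq (task R)) : Prop :=
  all (fun tau => [&& 0 <= slow_time tau, 0 <= fast_time tau
                    & 0 <= arrival tau]) T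
  /\ sorted (fun tau tau' => arrival tau <= arrival tau') T.

(* Since arrival times are nondecreasing, this is a prefix of [T], so tasks keep
   their indices under truncation. *)
Definition trunc (R : realType) (t : R) (T : seq (task R)) : seq (task R) :=
  [seq tau <- T | arrival tau <= t].

(* [None] is the fast machine and [Some k] the k-th slow machine. *)
Definition machine := option nat.
Definition fast : machine := None.
Definition slow (k : nat) : machine := Some k.

Definition runtime (R : realType) (tau : task R) (m : machine) : R :=
  if m is Some _ then slow_time tau else fast_time tau.

(* [mach i] is the machine to which task [i] is assigned, and [work m i] is the
   set of times at which machine [m] is working on task [i]. A task may be
   processed with interruptions. *)
Record schedule (R : realType) := Schedule {
  mach : nat -> machine;
  work : machine -> nat -> set R }.

Record valid (R : realType) (T : seq (task R)) (S : schedule R) : Prop := Valid {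
  valid_index : forall m i t, work S m i t -> (i < size T)%N;
  valid_one_task : forall m, trivIset setT (work S m);
  valid_arrival : forall m i t, work S m i t -> arrival (tsk T i) <= t;
  valid_one_machine : forall m i, m <> mach S i -> work S m i = set0;
  valid_measurable : forall m i, measurable (work S m i);
  valid_total : forall i, (i < size T)%N ->
    lebesgue_measure (work S (mach S i) i) =
      (runtime (tsk T i) (mach S i))%:E }.

(* All tasks are finished by time [c]. The clause [arrival _ <= c] matters only
   for tasks with zero runtime: it follows from the other one otherwise. *)
Definition finished_by (R : realType) (T : seq (task R)) (S : schedule R)
    (c : R) : Prop :=
  forall i, (i < size T)%N ->
    arrival (tsk T i) <= c /\
    lebesgue_measure (work S (mach S i) i `&` [set t | t <= c]) =
      (runtime (tsk T i) (mach S i))%:E.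

(* Extended-real valued, because a valid schedule may spread the work on a task
   over an unbounded set of times; its completion time is then +oo. *)
Definition completion (R : realType) (T : seq (task R)) (S : schedule R) : \bar R :=
  ereal_inf [set c%:E | c in [set c : R | 0 <= c /\ finished_by T S c]].

Definition opt (R : realType) (T : seq (task R)) : \bar R :=
  ereal_inf [set completion T S | S in [set S : schedule R | valid T S]].

Definition scheduler (R : realType) := seq (task R) -> schedule R.

(* What the machines do up to time [t] depends only on the tasks that have
   arrived by time [t]. *)
Definition online (R : realType) (A : scheduler R) : Prop :=
  forall (T T' : seq (task R)) (t : R), is_tap T -> is_tap T' ->
    trunc t T = trunc t T' ->
    forall m i s, s <= t -> (work (A T) m i s <-> work (A T') m i s).

(* The machine on which a task runs depends only on the tasks that have arrived
   by the arrival time of that task. *)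
Definition instantly_committing (R : realType) (A : scheduler R) : Prop :=
  forall (T T' : seq (task R)) (i : nat), is_tap T -> is_tap T' ->
    (i < size T)%N ->
    trunc (arrival (tsk T i)) T = trunc (arrival (tsk T i)) T' ->
    mach (A T) i = mach (A T') i.

Definition always_valid (R : realType) (A : scheduler R) : Prop :=
  forall T : seq (task R), is_tap T -> valid T (A T).

Definition competitive (R : realType) (c : R) (A : scheduler R) : Prop :=
  forall T : seq (task R), is_tap T -> (completion T (A T) <= c%:E * opt T)%E.

Section Ins.
Context (R : realType) (T : seq (task R)).

Definition ins_on_fast (i : nat) : bool :=
  (2%:R%:E * opt (trunc (arrival (tsk T i)) T)
     < (slow_time (tsk T i) + arrival (tsk T i))%:E)%E.

(* Every task that is not run on the fast machine gets a slow machine of its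
   own. *)
Definition ins_mach (i : nat) : machine := if ins_on_fast i then fast else slow i.

(* The time at which the fast machine has finished those of the first [i] tasks
   that are assigned to it, when it processes them in order of arrival and is
   idle only when there is nothing to do. *)
Fixpoint ins_fast_free (i : nat) : R :=
  if i is j.+1 then
    if ins_on_fast j then
      Num.max (ins_fast_free j) (arrival (tsk T j)) + fast_time (tsk T j)
    else ins_fast_free j
  else 0.

Definition ins_start (i : nat) : R :=
  if ins_on_fast i then Num.max (ins_fast_free i) (arrival (tsk T i))
  else arrival (tsk T i).

Definition ins_work (m : machine) (i : nat) : set R :=
  [set t | [/\ (i < size T)%N, m = ins_mach i
     & ins_start i <= t < ins_start i + runtime (tsk T i) (ins_mach i)]].

End Ins.

Definition ins (R : realType) : scheduler R :=
  fun T => Schedule (ins_mach T) (ins_work T).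

(* Main.v *)
Require Import Defs.
From mathcomp Require Import all_boot all_order all_algebra.
From mathcomp Require Import all_classical all_reals all_analysis.

(* Let F_k be the time at which the fast machine has finished its share of the
   first k tasks under ins, and C_k the optimum for these tasks. Strong
   induction on k gives F_k <= 2 C_k. Take a schedule S for the first k tasks
   whose completion time c is so close to C_k that S cannot afford to run task
   k-1 on a slow machine, and let i be the last task that ins runs on the fast
   machine and S on a slow one. Then c >= sigma_i + t_i > 2 C^{t_i} >= F_{i+1},
   and S runs on its fast machine all that ins runs on its own after i. If the
   latter is never idle after F_{i+1}, then F_k <= F_{i+1} + c <= 2c; otherwise
   its last busy period starts at an arrival time and ends by c. *)

Set Implicit Arguments.
Unset Strict Implicit.
Unset Printing Implicit Defensive.

Import Order.TTheory GRing.Theory Num.Theory.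

Local Open Scope classical_set_scope.
Local Open Scope ring_scope.

(** * Truncations of a task sequence as prefixes *)

Section Truncation.
Context (R : realType).
Implicit Types (T : seq (task R)) (t : R) (i j k : nat).

Lemma is_tap_ge0 T i : is_tap T -> (i < size T)%N ->
  [/\ 0 <= slow_time (tsk T i), 0 <= fast_time (tsk T i)
    & 0 <= arrival (tsk T i)].
Proof. by move=> [/all_nthP H _] /(H (task0 R)) /and3P[]. Qed.

Lemma arrival_le_trans :
  transitive (fun tau tau' : task R => arrival tau <= arrival tau').
Proof. by move=> y x z; exact: le_trans. Qed.

Lemma arrival_le T i j : is_tap T -> (i <= j)%N -> (j < size T)%N ->
  arrival (tsk T i) <= arrival (tsk T j).
Proof.
move=> [_ sT] ij jT; have iT := leq_ltn_trans ij jT.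
have rfT : reflexive (fun x y : task R => arrival x <= arrival y).
  by move=> x; exact: lexx.
exact: (sorted_leq_nth arrival_le_trans rfT (task0 R) sT).
Qed.

(** Arrivals are sorted, so once one task comes after [t], all later ones do. *)
Lemma trunc_take T t : is_tap T -> trunc t T = take (size (trunc t T)) T.
Proof.
move=> [_]; elim: T => //= tau T IH sT.
have [le_t|lt_t] := leP (arrival tau) t.
  by rewrite /= {1}IH //; exact: path_sorted sT.
suff -> : trunc t T = [::] by [].
have := order_path_min arrival_le_trans sT.
elim: T {IH sT} => //= x T IH /andP[tx aT].
by rewrite [arrival x <= t]leNgt (lt_le_trans lt_t tx) /= IH.
Qed.

Lemma tsk_trunc T t i : is_tap T -> (i < size (trunc t T))%N ->
  tsk (trunc t T) i = tsk T i.
Proof. by move=> tapT lti; rewrite trunc_take // /tsk nth_take. Qed.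

Lemma size_trunc_gt T t i : is_tap T -> (i < size T)%N ->
  arrival (tsk T i) <= t -> (i < size (trunc t T))%N.
Proof.
move=> tapT iT it; rewrite ltnNge; apply/negP => ni.
have : all (fun tau => arrival tau <= t) (take i.+1 T).
  apply/(all_nthP (task0 R)) => j; rewrite size_takel // ltnS => ji.
  by rewrite nth_take // (le_trans _ it) // (arrival_le tapT).
move=> /all_filterP tE; have := size_filter (fun tau : task R => arrival tau <= t) T.
rewrite -[T in count _ T](cat_take_drop i.+1) count_cat -size_filter tE.
rewrite size_takel // => sE.
by move: ni; rewrite /trunc sE addSn ltnNge leq_addr.
Qed.

Lemma trunc_arrival_le T t i : is_tap T -> (i < size (trunc t T))%N ->
  arrival (tsk T i) <= t.
Proof.
move=> tapT iT; rewrite -(tsk_trunc tapT iT).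
by have /(all_nthP (task0 R)) := filter_all (fun tau => arrival tau <= t) T; exact.
Qed.

Lemma trunc_trunc T s t : s <= t -> trunc s (trunc t T) = trunc s T.
Proof.
move=> st; rewrite /trunc -filter_predI; apply: eq_filter => x /=.
by case: (leP _ s) => //= /le_trans ->.
Qed.

End Truncation.

(** * Bounds on the optimum and on the schedules that approach it *)

Section Optimum.
Context (R : realType).
Implicit Types (T : seq (task R)) (S : schedule R) (c : R).

Lemma opt_ge0 T : (0 <= opt T)%E.
Proof.
apply: le_ereal_inf_tmp => _ [S _ <-]; apply: le_ereal_inf_tmp => _ [c [c0 _] <-].
by rewrite lee_fin.
Qed.

Lemma opt_le T S c : valid T S -> 0 <= c -> finished_by T S c ->
  (opt T <= c%:E)%E.
Proof.
move=> vS c0 fS; apply: (@le_trans _ _ (completion T S)).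
  by apply: ereal_inf_lbound; exists S.
by apply: ereal_inf_lbound; exists c.
Qed.

Lemma opt_lt T (x : R) : (opt T < x%:E)%E ->
  exists S c, [/\ valid T S, 0 <= c, finished_by T S c & c < x].
Proof.
move=> /ereal_inf_lt [_ [S vS <-]] /ereal_inf_lt [_ [c [c0 fc] <-]].
by rewrite lte_fin => cx; exists S, c.
Qed.

Lemma opt_take T k : (opt (take k T) <= opt T)%E.
Proof.
apply: le_ereal_inf_tmp => _ [S vS <-]; apply: le_ereal_inf_tmp => _ [c [c0 fc] <-].
have tE i : (i < size (take k T))%N ->
    (i < size T)%N /\ tsk (take k T) i = tsk T i.
  rewrite size_take_min leq_min => /andP[ik iT]; split=> //.
  by rewrite /tsk nth_take.
(* Dropping the work on the tasks from index [k] on leaves a schedule that is valid for the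
   prefix. *)
pose S' := Schedule (mach S) (fun m i =>
  if (i < size (take k T))%N then work S m i else set0).
apply: (@opt_le _ S') => //; last first.
  by move=> i iT; have [iT' ->] := tE _ iT; rewrite /S' /= iT; exact: fc.
split.
- by move=> m i t /=; case: ifP.
- move=> m i j _ _ [t /= []]; case: ifP => // _ wi; case: ifP => // _ wj.
  by apply: (valid_one_task vS (m := m)) => //; exists t.
- move=> m i t /=; case: ifP => // iT /(valid_arrival vS).
  by have [_ ->] := tE _ iT.
- by move=> m i mi /=; case: ifP => // _; exact: valid_one_machine vS _ _ mi.
- move=> m i /=; case: ifP => _; last exact: measurable0.
  exact: valid_measurable vS _ _.
- move=> i iT /=; have [iT' ->] := tE _ iT.
  by rewrite iT; exact: valid_total vS _ iT'.
Qed.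

Lemma lee_double (x : \bar R) : (0 <= x -> x <= 2%:R%:E * x)%E.
Proof.
by move=> x0; rewrite -[leLHS]mul1e lee_wpmul2r // lee_fin ler1n.
Qed.

Lemma lebesgue_itvcc (a b : R) : a <= b ->
  lebesgue_measure `[a, b] = (b - a)%:E.
Proof.
rewrite lebesgue_measure_itv /= lte_fin le_eqVlt => /predU1P[->|->//].
by rewrite ltxx subrr.
Qed.

Lemma measurable_work_le T S c m i : valid T S ->
  measurable (work S m i `&` [set t | t <= c]).
Proof.
move=> vS; apply: measurableI; first exact: valid_measurable vS _ _.
by rewrite (_ : [set t | t <= c] = `]-oo, c]%classic) //; apply/seteqP;
  split=> x /=; rewrite in_itv.
Qed.

(** The work on task [i] up to time [c] lies between its arrival and [c], so its measure is at most
    the length of that interval. *)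
Lemma slow_finish_le T S c i : valid T S -> finished_by T S c ->
  (i < size T)%N -> mach S i <> fast ->
  slow_time (tsk T i) + arrival (tsk T i) <= c.
Proof.
move=> vS fS iT; have [ac] := fS _ iT.
case: (mach S i) => [k /= mE _|//].
rewrite -lerBrDr -lee_fin -mE -lebesgue_itvcc //.
apply: le_measure; rewrite ?inE.
- exact: measurable_work_le vS.
- exact: measurable_itv.
- by move=> t /= [/(valid_arrival vS) ? ?]; rewrite in_itv /=; apply/andP.
Qed.

(** The work sets of these tasks on the fast machine are disjoint subsets of [[b, c]], so their
    measures add up to at most [c - b]. *)
Lemma fast_load_le T S c (P : pred nat) (b : R) j : valid T S ->
  finished_by T S c -> b <= c ->
  (forall l, (j <= l < size T)%N -> P l ->
     mach S l = fast /\ b <= arrival (tsk T l)) ->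
  b + \sum_(j <= l < size T | P l) fast_time (tsk T l) <= c.
Proof.
move=> vS fS bc HP; rewrite big_geq_mkord addrC -lerBrDr -lee_fin.
pose W (l : 'I_(size T)) := work S fast l `&` [set t | t <= c].
have mW l : measurable (W l) by exact: measurable_work_le vS.
have tW : trivIset [set: 'I_(size T)] W.
  move=> i l _ _ [t [[wi _] [wl _]]]; apply/val_inj.
  by apply: (valid_one_task vS (m := fast)) => //; exists t.
have <- : lebesgue_measure (\big[setU/set0]_(i < size T | P i && (j <= i)%N) W i)
    = (\sum_(i < size T | P i && (j <= i)%N) fast_time (tsk T i))%:E.
  rewrite -sumEFin; apply: etrans (measure_bigsetU_ord lebesgue_measure _ mW tW) _.
  apply: eq_bigr => i /andP[Pi ji].
  have [|mE _] := HP i _ Pi; first by rewrite ji ltn_ord.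
  by have [_] := fS _ (ltn_ord i); rewrite mE.
rewrite -lebesgue_itvcc //; apply: le_measure; rewrite ?inE.
- by apply: bigsetU_measurable => i _; exact: mW.
- exact: measurable_itv.
- rewrite -bigcup_seq_cond => t [i /= /andP[_ /andP[Pi ji]] [/(valid_arrival vS) it tc]].
  have [|_ bi] := HP i _ Pi; first by rewrite ji ltn_ord.
  by rewrite in_itv /= tc (le_trans bi it).
Qed.

End Optimum.

(** * The decisions of [ins] depend only on the past *)

Section InsCausality.
Context (R : realType).
Implicit Types (T : seq (task R)) (t : R).

Lemma tsk_trunc_eq T T' t i : is_tap T -> is_tap T' ->
  trunc t T = trunc t T' -> (i < size (trunc t T))%N -> tsk T i = tsk T' i.
Proof.
move=> tT tT' E iT; rewrite -(tsk_trunc tT iT) E tsk_trunc // -E//.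
Qed.

(** The rule looks at the truncation at the arrival of task [i], which is itself a truncation of the
    common one at [t]. *)
Lemma ins_on_fast_eq T T' t i : is_tap T -> is_tap T' ->
  trunc t T = trunc t T' -> (i < size (trunc t T))%N ->
  ins_on_fast T i = ins_on_fast T' i.
Proof.
move=> tT tT' E iT; have at_ := trunc_arrival_le tT iT.
rewrite /ins_on_fast -(tsk_trunc_eq tT tT' E iT).
by rewrite -(trunc_trunc T at_) -(trunc_trunc T' at_) E.
Qed.

Lemma ins_fast_free_eq T T' t i : is_tap T -> is_tap T' ->
  trunc t T = trunc t T' -> (i <= size (trunc t T))%N ->
  ins_fast_free T i = ins_fast_free T' i.
Proof.
move=> tT tT' E; elim: i => //= i IH iT.
by rewrite IH ?(ltnW iT) // (ins_on_fast_eq tT tT' E iT) (tsk_trunc_eq tT tT' E iT).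
Qed.

Lemma arrival_le_ins_start T i : arrival (tsk T i) <= ins_start T i.
Proof. by rewrite /ins_start; case: ifP => // _; rewrite le_max lexx orbT. Qed.

(** A task worked on at a time [s <= t] has arrived by [t], hence lies in the common truncation,
    which determines its machine and its start. *)
Lemma ins_online : online (@ins R).
Proof.
suff H T T' t m i s : is_tap T -> is_tap T' -> trunc t T = trunc t T' ->
    s <= t -> work (ins T) m i s -> work (ins T') m i s.
  by move=> T T' t tT tT' E m i s st; split; apply: H st.
move=> tT tT' E st [iT mE /andP[s1 s2]].
have it : (i < size (trunc t T))%N.
  by apply: size_trunc_gt => //; rewrite (le_trans (arrival_le_ins_start T i)) // (le_trans s1).
have mE' : ins_mach T i = ins_mach T' i by rewrite /ins_mach (ins_on_fast_eq tT tT' E it).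
have sE : ins_start T i = ins_start T' i.
  rewrite /ins_start (ins_on_fast_eq tT tT' E it) (tsk_trunc_eq tT tT' E it).
  by rewrite (ins_fast_free_eq tT tT' E (ltnW it)).
split.
- by move: it; rewrite E (trunc_take t tT') size_take_min leq_min => /andP[].
- by rewrite -mE'.
- by rewrite -mE' -sE -(tsk_trunc_eq tT tT' E it) s1.
Qed.

Lemma ins_instantly_committing : instantly_committing (@ins R).
Proof.
move=> T T' i tT tT' iT E /=.
by rewrite /ins_mach (ins_on_fast_eq tT tT' E) // size_trunc_gt.
Qed.

End InsCausality.

(** * Validity and competitive ratio of [ins] *)

Section InsCompetitive.
Context (R : realType) (T : seq (task R)) (tapT : is_tap T).

Lemma ins_fast_free_le i j : (i <= j <= size T)%N ->
  ins_fast_free T i <= ins_fast_free T j.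
Proof.
move=> /andP[]; elim: j => [|j IH]; first by rewrite leqn0 => /eqP->.
rewrite leq_eqVlt => /predU1P[-> //|]; rewrite ltnS => ij jT.
apply: (le_trans (IH ij (ltnW jT))) => /=; case: ifP => // _.
have [_ f0 _] := is_tap_ge0 tapT jT.
by rewrite (@le_trans _ _ (Num.max (ins_fast_free T j) (arrival (tsk T j)))) ?lerDl // le_max lexx.
Qed.

Lemma ins_valid : valid T (ins T).
Proof.
have runtime_ge0 i : (i < size T)%N -> 0 <= runtime (tsk T i) (ins_mach T i).
  by move=> /(is_tap_ge0 tapT)[s0 f0 _]; case: (ins_mach T i).
split => /=.
- by move=> m i t [].
(* Two slow tasks have different machines. If both are fast, task [i] ends at
   [ins_fast_free T i.+1], which is at most [ins_fast_free T j] and so at most the start of [j]. *)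
- have disj m i j t : (i < j)%N -> ins_work T m i t -> ~ ins_work T m j t.
    move=> ij [iT -> /andP[_ it]] [jT mE /andP[jt _]].
    have := ins_fast_free_le (i := i.+1) (j := j); rewrite ij (ltnW jT) => /(_ isT).
    move: mE it jt; rewrite /ins_mach /ins_start /=.
    case: (ins_on_fast T i); case: (ins_on_fast T j) => //=; last first.
      by move=> [ijE]; move: ij; rewrite ijE ltnn.
    move=> _; rewrite ge_max => lt1 /andP[le1 _] le2.
    by have := lt_le_trans lt1 (le_trans le2 le1); rewrite ltxx.
  move=> m i j _ _ [t [wi wj]]; have [ij|ji|//] := ltngtP i j.
    by case: (disj m i j t).
  by case: (disj m j i t).
- by move=> m i t [iT _ /andP[/(le_trans (arrival_le_ins_start T i))]].
- by move=> m i mi; apply/seteqP; split=> // t [_ mE]; case: mi.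
- move=> m i; have [iT|iT] := boolP ((i < size T)%N); last first.
    by rewrite (_ : ins_work T m i = set0) ?measurable0//;
      apply/seteqP; split=> // t [iT']; rewrite iT' in iT.
  have [mE|mE] := eqVneq m (ins_mach T i); last first.
    rewrite (_ : ins_work T m i = set0); first exact: measurable0.
    by apply/seteqP; split=> // t [_ mE']; rewrite mE' eqxx in mE.
  rewrite (_ : ins_work T m i =
    `[ins_start T i, ins_start T i + runtime (tsk T i) (ins_mach T i)[%classic).
    exact: measurable_itv.
  apply/seteqP; split=> t /=; first by case; rewrite in_itv.
  by rewrite in_itv.
- move=> i iT; rewrite (_ : ins_work T _ i =
    `[ins_start T i, ins_start T i + runtime (tsk T i) (ins_mach T i)[%classic).
    rewrite lebesgue_measure_itv /= lte_fin ltrDl -EFinB addrAC subrr add0r.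
    have := runtime_ge0 i iT; rewrite le_eqVlt => /predU1P[<-|->//].
    by rewrite ltxx.
  apply/seteqP; split=> t /=; first by case; rewrite in_itv.
  by rewrite in_itv.
Qed.

(* Either the fast machine is never idle after it finished the tasks before
   [a], or its last busy period starts at the arrival of some task [j >= a]. *)
Lemma ins_fast_free_busy a k : (a <= k)%N ->
  ins_fast_free T k <= ins_fast_free T a +
    \sum_(a <= l < k | ins_on_fast T l) fast_time (tsk T l) \/
  exists2 j, (a <= j < k)%N & ins_fast_free T k <= arrival (tsk T j) +
    \sum_(j <= l < k | ins_on_fast T l) fast_time (tsk T l).
Proof.
have recr j k' : (j <= k')%N ->
    \sum_(j <= l < k'.+1 | ins_on_fast T l) fast_time (tsk T l) =
    \sum_(j <= l < k' | ins_on_fast T l) fast_time (tsk T l) +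
    (if ins_on_fast T k' then fast_time (tsk T k') else 0).
  by move=> jk; rewrite big_mkcond big_nat_recr //= -big_mkcond.
elim: k => [|k IH]; first by rewrite leqn0 => /eqP->; left; rewrite big_geq // addr0.
rewrite leq_eqVlt => /predU1P[->|]; first by left; rewrite big_geq // addr0.
rewrite ltnS => ak /=.
have [fk|nfk] := boolP (ins_on_fast T k); last first.
  case: (IH ak) => [H|[j /andP[aj jk] H]].
    by left; rewrite recr // (negPf nfk) addr0.
  right; exists j; first by rewrite aj ltnS ltnW.
  by rewrite recr ?(ltnW jk) // (negPf nfk) addr0.
(* If the fast machine is free when task [k] arrives, a new busy period starts with [j := k];
   otherwise task [k] extends the current one. *)
have [le_a|lt_a] := leP (ins_fast_free T k) (arrival (tsk T k)).
  right; exists k; first by rewrite ak ltnSn.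
  by rewrite recr // fk big_geq // add0r.
case: (IH ak) => [H|[j /andP[aj jk] H]].
  by left; rewrite recr // fk addrA lerD2r.
right; exists j; first by rewrite aj ltnS ltnW.
by rewrite recr ?(ltnW jk) // fk addrA lerD2r.
Qed.

(** The truncation may reach beyond index [i], as later tasks can arrive at the same time. Passing
    to prefixes makes the rule of [ins] fit an induction on the number of tasks. *)
Lemma opt_take_le_trunc i : (i < size T)%N ->
  (opt (take i.+1 T) <= opt (trunc (arrival (tsk T i)) T))%E.
Proof.
move=> iT; have lt := size_trunc_gt tapT iT (lexx _).
by rewrite [in leRHS](trunc_take _ tapT) -{1}(take_takel T lt); exact: opt_take.
Qed.

Lemma opt_trunc_le t : (opt (trunc t T) <= opt T)%E.
Proof. by rewrite (trunc_take t tapT); exact: opt_take. Qed.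

Lemma ins_fast_free_opt k : (k <= size T)%N ->
  ((ins_fast_free T k)%:E <= 2%:R%:E * opt (take k T))%E.
Proof.
elim/ltn_ind: k => -[_ _|k IH kT].
  by rewrite mule_ge0 ?opt_ge0.
have [fk|nfk] := boolP (ins_on_fast T k); last first.
  rewrite /= (negPf nfk) (le_trans (IH k _ (ltnW kT))) //.
  by rewrite lee_wpmul2l // -(take_takel T (leqnSn k)) opt_take.
have size_k : size (take k.+1 T) = k.+1 by rewrite size_takel.
have tE l : (l < k.+1)%N -> tsk (take k.+1 T) l = tsk T l.
  by move=> lk; rewrite /tsk nth_take.
have lt_slow i : (i < k.+1)%N -> ins_on_fast T i ->
    (2%:R%:E * opt (take i.+1 T) <
     (slow_time (tsk T i) + arrival (tsk T i))%:E)%E.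
  move=> ik; apply: le_lt_trans; rewrite lee_wpmul2l //.
  by apply: opt_take_le_trunc; exact: leq_trans kT.
rewrite leNgt; apply/negP => lt_free.
(* The strict inequality assumed for contradiction also excludes an infinite optimum. *)
have lt1 : (opt (take k.+1 T) < (ins_fast_free T k.+1 / 2%:R)%:E)%E.
  move: lt_free; case: (opt (take k.+1 T)) (opt_ge0 (take k.+1 T)) => [r||] //.
  - by rewrite -EFinM !lte_fin ltr_pdivlMr // mulrC.
  - by rewrite gt0_muley // lte_fin.
have lt2 := le_lt_trans (lee_double (opt_ge0 _)) (lt_slow k (ltnSn k) fk).
(* The first bound on [c] is the one to contradict; the second forbids [S] to run task [k] on a slow
   machine. *)
have := @opt_lt R (take k.+1 T) (Num.min (ins_fast_free T k.+1 / 2%:R)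
                                    (slow_time (tsk T k) + arrival (tsk T k))).
rewrite EFin_min lt_min lt1 lt2 => /(_ isT)[S [c [vS c0 fS]]].
rewrite lt_min => /andP[]; rewrite ltr_pdivlMr // => lt_c lt_ck.
suff : ins_fast_free T k.+1 <= c + c.
  by move=> /le_lt_trans; rewrite -mulr2n -mulr_natr => /(_ _ lt_c); rewrite ltxx.
have load b j : b <= c -> (forall l, (j <= l < k.+1)%N -> ins_on_fast T l ->
     mach S l = fast /\ b <= arrival (tsk T l)) ->
    b + \sum_(j <= l < k.+1 | ins_on_fast T l) fast_time (tsk T l) <= c.
  move=> bc Hl.
  have := @fast_load_le _ _ _ _ (ins_on_fast T) b j vS fS bc.
  rewrite size_k => /(_ _)/(le_trans _); apply.
    rewrite lerD2l !(big_mkcond (ins_on_fast T)) le_eqVlt; apply/orP; left.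
    by apply/eqP/eq_big_nat => l /andP[_ /tE ->].
  by move=> l lk fl; rewrite tE; [exact: Hl|case/andP: lk].
have arr l : (l < k.+1)%N -> arrival (tsk T l) <= c.
  by move=> lk; have [] := fS l; rewrite ?size_k // tE.
pose on_slow i := [&& (i < k.+1)%N, ins_on_fast T i & mach S i != fast].
have slow_le i : on_slow i -> slow_time (tsk T i) + arrival (tsk T i) <= c.
  move=> /and3P[ik _ /eqP mi]; rewrite -tE //.
  by apply: (slow_finish_le vS fS) => //; rewrite size_k.
(* [a] is one past the last task that is fast under [ins] and slow under [S], or 0 if there is
   none. *)
have [a [ak Fa Ha]] : exists a, [/\ (a <= k.+1)%N, ins_fast_free T a <= c
    & forall l, (a <= l < k.+1)%N -> ins_on_fast T l -> mach S l = fast].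
  have [ex|nex] := pselect (exists i, on_slow i); last first.
    exists 0%N; split=> // l lk fl; apply/eqP; apply: contra_notT nex => ml.
    by exists l; apply/and3P; split.
  have bnd i : on_slow i -> (i <= k)%N by case/and3P.
  have [i si maxi] := ex_maxnP ex bnd.
  have [ik fi _] := and3P si.
  have {}ik : (i < k)%N.
    move: ik; rewrite ltnS leq_eqVlt => /predU1P[iE|//].
    by have := le_lt_trans (slow_le _ si) lt_ck; rewrite iE ltxx.
  exists i.+1; split; first exact: ltnW.
    (* Since [i < k], induction applies to the first [i.+1] tasks: [ins_fast_free T i.+1] is at most
       twice their optimum, which the rule puts below the slow finishing time of [i]. *)
    apply: le_trans (slow_le _ si); rewrite -lee_fin ltW //.
    by apply: le_lt_trans (lt_slow i (ltnW ik) fi); apply: IH => //; exact: ltn_trans kT.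
  move=> l /andP[il lk] fl; apply/eqP; apply: contraLR il => ml.
  by rewrite -leqNgt; apply: maxi; apply/and3P.
(* Without idling, both [ins_fast_free T a] and the later load ([b := 0]) are at most [c]. In the
   other case, [b := arrival (tsk T j)] bounds the whole by a single [c]. *)
have [H|[j /andP[aj jk] H]] := ins_fast_free_busy ak; apply: (le_trans H).
  rewrite lerD // -[leLHS]add0r; apply: load => // l lk fl; split; first exact: Ha.
  have /andP[_ lk'] := lk.
  by have [] := is_tap_ge0 tapT (leq_trans lk' kT).
rewrite -[leLHS]addr0 lerD // load ?arr // => l /andP[jl lk] fl; split.
  by apply: Ha => //; rewrite lk (leq_trans aj jl).
by rewrite (arrival_le tapT) // (leq_trans lk kT).
Qed.

Lemma ins_completion : (completion T (ins T) <= 2%:R%:E * opt T)%E.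
Proof.
have c0 : (0 <= 2%:R%:E * opt T)%E by rewrite mule_ge0 ?opt_ge0.
have finish i : (i < size T)%N ->
    ((ins_start T i + runtime (tsk T i) (ins_mach T i))%:E
       <= 2%:R%:E * opt T)%E.
  (* A fast task ends by the time the fast machine has done its whole share; for a slow one the
     bound is the negated test of [ins]. *)
  move=> iT; rewrite /ins_start /ins_mach; case: ifPn => fi.
    have := ins_fast_free_opt (leqnn _); rewrite take_size; apply: le_trans.
    have := ins_fast_free_le (i := i.+1) (j := size T).
    by rewrite iT leqnn lee_fin /= fi => /(_ isT).
  rewrite addrC; apply: (@le_trans _ _ (2%:R%:E * opt (trunc (arrival (tsk T i)) T))%E).
    by rewrite leNgt.
  by rewrite lee_wpmul2l // opt_trunc_le.
(* An infinite optimum leaves nothing to prove; otherwise twice the optimum is itself a time by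
   which all tasks are finished. *)
case: (2%:R%:E * opt T)%E c0 finish => [c||] //= c0 finish; last by rewrite leey.
apply: ereal_inf_lbound; exists c => //; split; first by rewrite -lee_fin.
move=> i iT; have := finish i iT; rewrite lee_fin => ec.
have r0 : 0 <= runtime (tsk T i) (ins_mach T i).
  by have [s0 f0 _] := is_tap_ge0 tapT iT; case: (ins_mach T i).
split.
  by rewrite (le_trans (arrival_le_ins_start T i)) // (le_trans _ ec) // lerDl.
rewrite setIidl; first exact: valid_total ins_valid _ iT.
by move=> t [_ _ /andP[_ /ltW te]] /=; exact: le_trans ec.
Qed.

End InsCompetitive.

Theorem theorem3p2 (R : realType) :
  [/\ always_valid (@ins R), online (@ins R), instantly_committing (@ins R)
    & competitive (2%:R)%R (@ins R)].
Proof.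
split.
- by move=> T; exact: ins_valid.
- exact: ins_online.
- exact: ins_instantly_committing.
- by move=> T; exact: ins_completion.
Qed.
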